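(* Let $n, r \in \mathbb{N}$. Then: (i) if $n \geq 2r+2$, then $a_{antisym}^{\mathbb{R}}(n;2r) = (n-r-1)\,r$; (ii) if $n = 2r$, then $a_{antisym}^{\mathbb{R}}(n;2r) = r(r-1)$; (iii) if $n = 2r+1$, then $a_{antisym}^{\mathbb{R}}(n;2r) = r(r+1)$.
   Context: For $n \in \mathbb{N}$, $A(n,\mathbb{R})$ denotes the real vector space of antisymmetric $n\times n$ matrices over $\mathbb{R}$. An affine subspace $S$ of $A(n,\mathbb{R})$ (a translate $M+L$ of a linear subspace $L \subseteq A(n,\mathbb{R})$ by some $M\in A(n,\mathbb{R})$, with $\dim S = \dim L$) is said to have constant rank $k$ if every matrix in $S$ has rank $k$. The number $a_{antisym}^{\mathbb{R}}(n;k)$ is the maximum of $\dim S$ over all affine subspaces $S$ of $A(n,\mathbb{R})$ of constant rank $k$. *)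

(* Defs.v *)
From mathcomp Require Import all_boot all_algebra.

Set Implicit Arguments.
Unset Strict Implicit.
Unset Printing Implicit Defensive.

Import GRing.Theory.
Local Open Scope ring_scope.

(* The translate [origin + direction]. Distinct records may have the same
   points, but the points determine the direction, hence the dimension. *)
Record affspace (F : fieldType) (vT : vectType F) := AffSpace {
  origin : vT;
  direction : {vspace vT}
}.

Definition mem_affspace (F : fieldType) (vT : vectType F) (S : affspace vT)
  : {pred vT} := [pred x | x - origin S \in direction S].

Canonical affspace_predType (F : fieldType) (vT : vectType F) :=
  PredType (@mem_affspace F vT).

Definition affdim (F : fieldType) (vT : vectType F) (S : affspace vT) : nat :=
  \dim (direction S).

Lemma in_affspace (F : fieldType) (vT : vectType F) (S : affspace vT) (x : vT) :
  (x \in S) = (x - origin S \in direction S).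
Proof. by []. Qed.

Definition antisymmx (F : fieldType) (n : nat) : {pred 'M[F]_n} :=
  [pred A | A^T == - A].
Arguments antisymmx : clear implicits.

Definition constant_rank (F : fieldType) (n k : nat) (S : affspace 'M[F]_n)
  : Prop := forall A : 'M[F]_n, A \in S -> \rank A = k.

Definition antisym_constant_rank_dim (F : fieldType) (n k d : nat) : Prop :=
  exists S : affspace 'M[F]_n,
    [/\ {subset S <= antisymmx F n}, constant_rank k S & affdim S = d].

Definition is_maximum (P : nat -> Prop) (m : nat) : Prop :=
  P m /\ forall d : nat, P d -> (d <= m)%N.

(* [a_antisym_eq F n k m] reads "a_antisym(n; k) = m". This is a relation and
   not a function because for some n and k (e.g. k odd) there is no antisymmetric
   affine subspace of constant rank k, so that the maximum does not exist. *)
Definition a_antisym_eq (F : fieldType) (n k m : nat) : Prop :=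
  is_maximum (antisym_constant_rank_dim F n k) m.

(* Main.v *)
From HB Require Import structures.
Require Import Defs.
From mathcomp Require Import all_boot all_order all_algebra.
From mathcomp Require Import complex sesquilinear spectral.
From mathcomp Require Import reals ring zify.

(** Let S = M + L be an affine space of antisymmetric matrices of constant
    rank 2r, of size n = 2r + m.

    Upper bound. A congruence brings M to the block form J (+) 0, where J is
    the standard symplectic matrix of size 2r ([antisym_normal_form]). Write
    A in L in blocks, with corner X of size 2r and border B of size 2r x m.
    Since M + tA has rank 2r for every t, the Schur complement of J + tX in
    M + tA vanishes for all but finitely many t, and its expansion at t = 0
    shows that the lower right block of A is 0 and that B^T J^-1 B = 0
    ([constant_rank_pencil]). Then dim L is the dimension of the space V of
    the borders B plus that of the space K of the A in L with B = 0.

    - K has dimension at most r (r - 1) ([offherm_nonsingular_pencil]). For A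
      in K all the matrices J + tX are nonsingular. If X commutes with J,
      then J X is symmetric, so it is 0 unless it has a nonzero real
      eigenvalue, which would make some J + tX singular. Hence K meets
      trivially the r^2-dimensional space of the X that commute with J, whose
      codimension in the antisymmetric matrices is r (r - 1).

    - V has dimension at most 2r m, trivially, and at most r m when m >= 2:
      its elements have columns that are pairwise orthogonal for a symplectic
      form ([dim_isotropic]). For m = 1 antisymmetry makes the condition
      B^T J^-1 B = 0 empty.

    Lower bound ([antisym_constant_rank_exists]). The matrices with blocks
    X, U, -U^T, 0 of size r, with X antisymmetric and U unitriangular, are
    nonsingular and form an affine space of dimension r (r - 1). Bordering
    them by B keeps the rank when B^T N^-1 B = 0, N being the matrix which is
    bordered. This allows any column when m = 1, and, for every m, any B whose
    lower half is zero. The dimensions of the two bounds agree in each case. *)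

Set Implicit Arguments.
Unset Strict Implicit.
Unset Printing Implicit Defensive.

Import GRing.Theory Num.Theory.
Local Open Scope ring_scope.

(** * Linear algebra preliminaries *)

HB.instance Definition _ (F : pzRingType) m1 m2 n1 n2 :=
  GRing.Linear.copy (@ulsubmx F m1 m2 n1 n2) (lsubmx \o usubmx).
HB.instance Definition _ (F : pzRingType) m1 m2 n1 n2 :=
  GRing.Linear.copy (@ursubmx F m1 m2 n1 n2) (rsubmx \o usubmx).
HB.instance Definition _ (F : pzRingType) m1 m2 n1 n2 :=
  GRing.Linear.copy (@dlsubmx F m1 m2 n1 n2) (lsubmx \o dsubmx).
HB.instance Definition _ (F : pzRingType) m1 m2 n1 n2 :=
  GRing.Linear.copy (@drsubmx F m1 m2 n1 n2) (rsubmx \o dsubmx).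

Lemma dim_fullmx (F : fieldType) m n : \dim {:'M[F]_(m, n)} = (m * n)%N.
Proof. by rewrite dimvf. Qed.

Lemma antisym_congr (F : fieldType) p n (P : 'M[F]_(p, n)) (A : 'M[F]_n) :
  A^T = - A -> (P *m A *m P^T)^T = - (P *m A *m P^T).
Proof. by move=> aA; rewrite !trmx_mul trmxK aA mulNmx mulmxN mulmxA. Qed.

Lemma mxrank_congr (F : fieldType) n (P A : 'M[F]_n) :
  P \in unitmx -> \rank (P *m A *m P^T) = \rank A.
Proof.
move=> uP; rewrite mxrankMfree ?row_free_unit ?unitmx_tr // -mxrank_tr trmx_mul.
by rewrite mxrankMfree ?row_free_unit ?unitmx_tr // mxrank_tr.
Qed.

Lemma antisym_diag0 (F : numFieldType) n (A : 'M[F]_n) i :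
  A^T = - A -> A i i = 0.
Proof.
move/matrixP/(_ i i); rewrite !mxE => /eqP.
by rewrite -addr_eq0 -mulr2n mulrn_eq0 => /eqP.
Qed.

(** The rows of [block_mx P Q S T] all lie in the span of the top ones exactly
    when the Schur complement of [P] vanishes. *)
Lemma rank_block_schur (F : fieldType) k p q (P : 'M[F]_k) (Q : 'M_(k, q))
    (S : 'M_(p, k)) (T : 'M_(p, q)) :
  P \in unitmx ->
  (\rank (block_mx P Q S T) == k) = (T == S *m invmx P *m Q).
Proof.
move=> uP; have rkPQ : \rank (row_mx P Q) = k.
  apply/eqP; rewrite eqn_leq rank_leq_row /=.
  have {1}<- : \rank (row_mx P Q *m col_mx (invmx P) 0) = k.
    by rewrite mul_row_col mulmxV // mulmx0 addr0 mxrank1.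
  exact: mxrankM_maxl.
have subPQ : (row_mx P Q <= block_mx P Q S T)%MS.
  by rewrite /block_mx -addsmxE addsmxSl.
have [_] := mxrank_leqif_sup subPQ; rewrite rkPQ eq_sym => ->.
rewrite /block_mx -addsmxE addsmx_sub submx_refl /=.
apply/submxP/eqP => [[X]|->].
  by rewrite mul_mx_row => /eq_row_mx[-> ->]; rewrite mulmxK.
by exists (S *m invmx P); rewrite mul_mx_row mulmxKV.
Qed.

(** * Pencils of matrices of constant rank *)

(** The natural numbers provide more zeros of [d * p] than its degree allows. *)
Lemma poly_eq0_of_roots (F : numDomainType) (d p : {poly F}) :
  d != 0 -> (forall t, d.[t] != 0 -> p.[t] = 0) -> p = 0.
Proof.
move=> dN0 pz; have dp0 : d * p = 0.
  apply: (@roots_geq_poly_eq0 _ _ [seq i%:R | i <- iota 0 (size (d * p))]).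
  - apply/allP => x _; rewrite rootE hornerM mulf_eq0.
    by case: eqP => //= /eqP /pz ->.
  - by rewrite map_inj_uniq ?iota_uniq // => i j /eqP; rewrite eqr_nat => /eqP.
  - by rewrite size_map size_iota.
by move/eqP: dp0; rewrite mulf_eq0 (negPf dN0) => /eqP.
Qed.

(** The Schur complement t D - t^2 C (J + t A)^-1 B is zero whenever J + t A is
    invertible. After division by t and multiplication by det (J + t A) it is a
    polynomial in t with infinitely many zeros, hence identically zero; its
    terms of degree 0 and then 1 give the two conclusions. *)
Lemma constant_rank_pencil (F : numFieldType) k p q (J A : 'M[F]_k)
    (B : 'M_(k, q)) (C : 'M_(p, k)) (D : 'M_(p, q)) :
  J \in unitmx ->
  (forall t, \rank (block_mx (J + t *: A) (t *: B) (t *: C) (t *: D)) = k) ->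
  D = 0 /\ C *m invmx J *m B = 0.
Proof.
move=> uJ rk.
(* The adjugate replaces the inverse so that everything is polynomial in t. *)
pose P := map_mx polyC J + 'X *: map_mx polyC A.
pose N := map_mx polyC C *m \adj P *m map_mx polyC B.
have evC t m n (M : 'M[F]_(m, n)) : map_mx (horner_eval t) (map_mx polyC M) = M.
  by apply/matrixP => i j; rewrite !mxE /= horner_evalE hornerC.
have evP t : map_mx (horner_eval t) P = J + t *: A.
  by rewrite map_mxD map_mxZ !evC /= horner_evalE hornerX.
have evN t : map_mx (horner_eval t) N = C *m \adj (J + t *: A) *m B.
  by rewrite !map_mxM map_mx_adj !evC evP.
have evdet t : (\det P).[t] = \det (J + t *: A).
  by rewrite -horner_evalE -det_map_mx evP.
have detJ : \det J != 0 by rewrite -unitfE -unitmxE.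
have dP0 : (\det P).[0] != 0 by rewrite evdet scale0r addr0.
have PN0 : 'X * \det P != 0.
  rewrite mulf_neq0 ?polyX_eq0 //.
  by apply: contraNneq dP0 => ->; rewrite horner0.
have key i j : \det P * (D i j)%:P - 'X * N i j = 0.
  apply: (poly_eq0_of_roots PN0) => t.
  rewrite hornerM hornerX evdet mulf_eq0 negb_or => /andP[t0 dt].
  have ut : J + t *: A \in unitmx by rewrite unitmxE unitfE.
  have /eqP := rk t; rewrite rank_block_schur // => /eqP/matrixP/(_ i j).
  rewrite -!scalemxAl -!scalemxAr /invmx ut -!(scalemxAl, scalemxAr).
  have := evN t; set G := _ *m B => /matrixP/(_ i j).
  rewrite mxE horner_evalE => NE; clearbody G.
  rewrite !hornerE evdet NE => e.
  have {e} : t * D i j = t * (t * ((\det (J + t *: A))^-1 * G i j)).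
    by move: e; rewrite !mxE.
  by move/(mulfI t0) ->; field.
have D0 : D = 0.
  apply/matrixP => i j; have /(congr1 (horner^~ 0)) := key i j.
  rewrite hornerD hornerN !hornerM hornerX !hornerC mul0r subr0 => /eqP.
  by rewrite mulf_eq0 (negPf dP0) mxE => /eqP.
split=> //.
(* With [D = 0] the identity [key] can be divided by 'X. *)
have N0 i j : N i j = 0.
  have /eqP := key i j; rewrite D0 mxE polyC0 mulr0 sub0r oppr_eq0 mulf_eq0.
  by rewrite polyX_eq0 => /eqP.
rewrite /invmx uJ -scalemxAr -scalemxAl.
suff -> : C *m \adj J *m B = 0 by rewrite scaler0.
have := evN 0; rewrite scale0r addr0 => <-.
by apply/matrixP => i j; rewrite mxE N0 [RHS]mxE horner_evalE horner0.
Qed.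

(** A nonzero real symmetric matrix is diagonalizable with real eigenvalues,
    one of which, x, is nonzero; then 1 - x^-1 S is singular. The spectral
    theorem is applied to S seen as a Hermitian matrix over R[i]. *)
Lemma symmx_no_real_eigenvalue_eq0 (R : rcfType) k (S : 'M[R]_k) :
  S^T = S -> (forall t, 1%:M + t *: S \in unitmx) -> S = 0.
Proof.
move=> symS unitS; pose f : {rmorphism R -> R[i]} := real_complex R.
pose Sc := map_mx f S.
have hermSc : Sc \is hermsymmx.
  apply: realsym_hermsym.
    apply/is_hermitianmxP; rewrite expr0 scale1r map_mx_id //.
    by rewrite /Sc map_trmx symS.
  by apply/mxOverP => i j; rewrite mxE complex_real.
have /orthomx_spectralP Sspec := hermitian_normalmx hermSc.
have /mxOverP diag_real := hermitian_spectral_diag_real hermSc.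
apply/eqP; rewrite -(map_mx_eq0 f) -/Sc Sspec.
suff -> : spectral_diag Sc = 0 by rewrite raddf0 mulmx0 mul0mx eqxx.
apply/matrixP => i j; rewrite (ord1 i) [RHS]mxE.
apply/eqP/negPn/negP => ev0.
have /complex_realP[x xE] := diag_real 0 j.
have {}xE : spectral_diag Sc 0 j = f x by [].
have x0 : x != 0 by apply: contraNneq ev0 => x0; rewrite xE x0 rmorph0.
(* For t = - x^-1 the j-th diagonal entry 1 + t x vanishes. *)
have := unitS (- x^-1); rewrite -(map_unitmx f) => u.
have {u} : spectralmx Sc *m map_mx f (1%:M + (- x^-1) *: S) *m
    invmx (spectralmx Sc) \in unitmx.
  by rewrite !unitmx_mul u unitmx_inv spectral_unit.
rewrite map_mxD map_mx1 map_mxZ -/Sc [in X in _ *: X]Sspec.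
rewrite mulmxDr mulmxDl mulmx1 mulmxV ?spectral_unit // -scalemxAr -scalemxAl.
rewrite !mulmxA mulmxV ?spectral_unit // mul1mx mulmxK ?spectral_unit //.
rewrite unitmxE unitfE -scalemx1 -(diag_const_mx _ (1 : R[i])).
rewrite -!linearZ -linearD det_diag.
rewrite (bigD1 j) //= !mxE xE rmorphN fmorphV mulNr mulVf ?fmorph_eq0 //.
by rewrite mulr1 subrr mul0r eqxx.
Qed.

(** * Symplectic normal form *)

Definition symplmx (F : fieldType) r : 'M[F]_(r + r) :=
  block_mx 0 1%:M (- 1%:M) 0.

Lemma symplmx_sqr (F : fieldType) r : symplmx F r *m symplmx F r = - 1%:M.
Proof.
rewrite mulmx_block !mulmx0 !mul0mx mul1mx mulmx1 !add0r addr0.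
by rewrite [1%:M in RHS]scalar_mx_block opp_block_mx oppr0.
Qed.

Lemma symplmx_unit (F : fieldType) r : symplmx F r \in unitmx.
Proof.
suff /mulmx1_unit[] : symplmx F r *m - symplmx F r = 1%:M by [].
by rewrite mulmxN symplmx_sqr opprK.
Qed.

(** An isotropic U of dimension k < r has an orthogonal of dimension
    2r - k > k, and any vector of this orthogonal outside U extends U. *)
Lemma lagrangian_exists (F : numFieldType) r (N : 'M[F]_(r + r)) :
  N^T = - N -> N \in unitmx ->
  exists2 U : 'M_(r, r + r), row_free U & U *m N *m U^T = 0.
Proof.
move=> aN uN.
suff : forall k, (k <= r)%N ->
    exists2 U : 'M_(k, r + r), row_free U & U *m N *m U^T = 0 by apply.
elim=> [_|k IHk ltk].
  by exists 0; [rewrite /row_free mxrank0 | rewrite !mul0mx].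
have [U Ufree Uiso] := IHk (ltnW ltk).
pose O := kermx (N *m U^T).
have rkO : \rank O = (r + r - k)%N.
  rewrite mxrank_ker -mxrank_tr trmx_mul trmxK mxrankMfree ?(eqP Ufree) //.
  by rewrite aN row_free_unit -scaleN1r unitmxZ ?unitrN1.
have : ~~ (O <= U)%MS.
  by apply/negP => /mxrankS; rewrite rkO (eqP Ufree); lia.
case/row_subPn => i; set v := row i O => vNU.
have vO : v *m N *m U^T = 0 by rewrite -mulmxA -row_mul mulmx_ker row0.
have Ov : U *m N *m v^T = 0.
  apply: trmx_inj; rewrite !trmx_mul trmxK aN mulNmx mulmxN mulmxA vO.
  by rewrite oppr0 trmx0.
have vv : v *m N *m v^T = 0.
  apply/matrixP => a b; rewrite !ord1 antisym_diag0 ?mxE //.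
  exact: antisym_congr.
rewrite -add1n; exists (col_mx v U).
  rewrite /row_free eqn_leq rank_leq_row /=.
  have: (U < col_mx v U)%MS.
    by rewrite ltmxE -!addsmxE addsmxSr addsmx_sub (negPf vNU).
  by rewrite ltmxErank (eqP Ufree) => /andP[].
rewrite mul_col_mx tr_col_mx mul_col_mx !mul_mx_row vv vO Ov Uiso.
by rewrite -[RHS]block_mx0.
Qed.

(** A Lagrangian U has a complement W0 with U N W0^T = 1; a shear of W0 along U
    makes it isotropic too. *)
Lemma antisym_unit_normal_form (F : numFieldType) r (N : 'M[F]_(r + r)) :
  N^T = - N -> N \in unitmx ->
  exists2 P, P \in unitmx & P *m N *m P^T = symplmx F r.
Proof.
move=> aN uN; have [U Ufree Uiso] := lagrangian_exists aN uN.
pose W0 := (pinvmx (U *m N))^T.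
have UW0 : U *m N *m W0^T = 1%:M.
  by rewrite trmxK mulmxVp // /row_free mxrankMfree ?row_free_unit.
pose C := W0 *m N *m W0^T.
have aC : C^T = - C by apply: antisym_congr.
(* Adding [a *: C *m U] to [W0] adds [(2 * a) *: C] to the Gram matrix [C]. *)
pose a : F := - 2^-1; pose W := W0 + a *: C *m U.
have UW : U *m N *m W^T = 1%:M.
  by rewrite linearD /= trmx_mul mulmxDr UW0 mulmxA Uiso mul0mx addr0.
have skew p q (X : 'M_(p, _)) (Y : 'M_(q, _)) :
    X *m N *m Y^T = - (Y *m N *m X^T)^T.
  by rewrite !trmx_mul trmxK aN mulNmx mulmxN opprK mulmxA.
have WU : W *m N *m U^T = - 1%:M by rewrite skew UW trmx1.
have WW : W *m N *m W^T = 0.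
  rewrite {1}/W !mulmxDl -!mulmxA [U *m _]mulmxA UW mulmx1 mulmxA.
  rewrite linearD /= mulmxDr -/C trmx_mul mulmxA [W0 *m N *m U^T]skew UW0 trmx1.
  rewrite linearZ /= aC mulNmx mul1mx scalerN opprK -addrA -scalerDl.
  rewrite -{1}[C]scale1r.
  by rewrite -scalerDl (_ : _ + _ = 0) ?scale0r // /a; field.
have PNP : col_mx U W *m N *m (col_mx U W)^T = symplmx F r.
  by rewrite mul_col_mx tr_col_mx mul_col_mx !mul_mx_row Uiso UW WU WW.
exists (col_mx U W) => //.
by have := symplmx_unit F r; rewrite -PNP !unitmx_mul => /andP[/andP[]].
Qed.

Lemma antisym_normal_form (F : numFieldType) r m (M : 'M[F]_(r + r + m)) :
  M^T = - M -> \rank M = (r + r)%N ->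
  exists2 P, P \in unitmx & P *m M *m P^T = block_mx (symplmx F r) 0 0 0.
Proof.
move=> aM rkM; pose P1 := invmx (col_ebase M).
have uP1 : P1 \in unitmx by rewrite unitmx_inv col_ebase_unit.
pose X := P1 *m M *m P1^T.
have aX : X^T = - X by apply: antisym_congr.
(* The last m rows of [P1 *m M] are zero because M has rank r + r. *)
have XE : X = block_mx (ulsubmx X) 0 0 0.
  have dX : dsubmx X = 0.
    rewrite /X -{1}(mulmx_ebase M) rkM !mulmxA {1}/P1 mulVmx ?col_ebase_unit //.
    rewrite mul1mx.
    rewrite pid_mx_block -!mulmxA block_mxEv mul_col_mx col_mxKd.
    by rewrite row_mx0 mul0mx.
  have /matrixP rX : rsubmx X = 0.
    apply: trmx_inj; rewrite trmx_rsub aX trmx0.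
    apply/matrixP => i j; move/matrixP: dX => /(_ i j); rewrite !mxE => ->.
    by rewrite oppr0.
  rewrite -[LHS]submxK; congr block_mx.
  - by apply/matrixP => i j; have := rX (lshift m i) j; rewrite !mxE.
  - by rewrite /dlsubmx dX; apply/matrixP => i j; rewrite !mxE.
  - by rewrite /drsubmx dX; apply/matrixP => i j; rewrite !mxE.
pose N := ulsubmx X.
have aN : N^T = - N by rewrite trmx_ulsub aX linearN.
have uN : N \in unitmx.
  have : \rank X = (r + r)%N by rewrite mxrank_congr.
  rewrite XE rank_diag_block_mx mxrank0 addn0 -row_free_unit.
  by rewrite /row_free => ->.
have [P2 uP2 P2N] := antisym_unit_normal_form aN uN.
exists (block_mx P2 0 0 1%:M *m P1).
  by rewrite unitmx_mul uP1 andbT unitmxE det_ublock det1 mulr1 -unitmxE.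
rewrite trmx_mul -!mulmxA [M *m _]mulmxA [P1 *m _]mulmxA [P1 *m _]mulmxA.
rewrite -/X XE -/N.
rewrite tr_block_mx !mulmx_block !trmx0 trmx1.
by rewrite !(mulmx0, mul0mx, addr0, add0r) mulmxA P2N.
Qed.

(** * Isotropic spaces of matrices *)

(** [mulmx G] maps onto the matrices with dim U rows, when the rows of G form a
    basis of U, and V lies in its kernel. *)
Lemma dim_annihilator (F : fieldType) n k (U : {vspace 'rV[F]_n})
    (V : {vspace 'M[F]_(n, k)}) :
  (forall u B, u \in U -> B \in V -> u *m B = 0) ->
  (\dim V + \dim U * k <= n * k)%N.
Proof.
move=> UV; pose G := \matrix_(i < \dim U) (vbasis U)`_i.
have Gfree : row_free G.
  rewrite -kermx_eq0; apply/rowV0P => c /sub_kermxP cG0; apply/rowP => i.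
  have /freeP := basis_free (vbasisP U); rewrite mxE; apply.
  by rewrite -[RHS]cG0 mulmx_sum_row; apply: eq_bigr => j _; rewrite rowK.
pose f := linfun (mulmx G : 'M_(n, k) -> 'M_(\dim U, k)).
have f_full : limg f = fullv.
  apply/vspaceP => Y; rewrite memvf; apply/memv_imgP.
  exists (pinvmx G *m Y); first exact: memvf.
  by rewrite lfunE /= mulmxA mulmxVp ?mul1mx.
have Vker : (V <= lker f)%VS.
  apply/subvP => B VB; rewrite memv_ker lfunE /=; apply/eqP/row_matrixP => i.
  rewrite row_mul row0 rowK; apply: UV => //.
  by rewrite vbasis_mem // mem_nth // size_tuple.
have := limg_ker_dim f fullv; rewrite capfv f_full !dim_fullmx => <-.
by rewrite leq_add2r dimvS.
Qed.

Lemma mul_tr_row_mx (F : fieldType) n p q (J : 'M[F]_n) (A C : 'M_(n, p))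
    (B D : 'M_(n, q)) :
  (row_mx A B)^T *m J *m row_mx C D =
  block_mx (A^T *m J *m C) (A^T *m J *m D) (B^T *m J *m C) (B^T *m J *m D).
Proof. by rewrite tr_row_mx mul_col_mx mul_col_row. Qed.

(** Induction on the number of columns. Let U be the space of the first columns
    of the elements of V, of dimension u, and W the space of the elements with
    first column 0. The hypothesis on an element of V and an element of W says,
    in its first row, that the columns of W are J-orthogonal to U, so
    dim W <= (2r - u) (m - 1), where m is the number of columns of V. If
    u <= r, the bound on dim W given by the induction suffices when m > 2; if
    u > r, or if m = 2, the inequality just obtained suffices. *)
Lemma dim_isotropic (F : fieldType) r m (J : 'M[F]_(r + r))
    (V : {vspace 'M[F]_(r + r, m)}) :
  J \in unitmx ->
  (forall A B, A \in V -> B \in V -> A^T *m J *m B + B^T *m J *m A = 0) ->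
  (2 <= m)%N -> (\dim V <= r * m)%N.
Proof.
move=> uJ; case: m V => // m; rewrite -add1n.
elim: m => // m IHm V isoV _.
pose f := linfun (mulmxr J \o trmx \o
  (lsubmx : 'M[F]_(r + r, 1 + m.+1) -> 'M_(r + r, 1))).
have fE A : f A = (lsubmx A)^T *m J by rewrite lfunE.
pose g := linfun (rsubmx : 'M[F]_(r + r, 1 + m.+1) -> 'M_(r + r, m.+1)).
have kerP A : A \in lker f -> A = row_mx 0 (g A).
  rewrite memv_ker fE => /eqP/(canRL (mulmxK uJ)); rewrite mul0mx => l0.
  by rewrite lfunE -[A in LHS]hsubmxK -[lsubmx A]trmxK l0 trmx0.
set K := (V :&: lker f)%VS; set U := (f @: V)%VS; set W := (g @: K)%VS.
have dimW : \dim W = \dim K.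
  apply: limg_dim_eq; apply/eqP; rewrite -subv0; apply/subvP => A.
  rewrite !memv_cap => /andP[/andP[_ /kerP eA]]; rewrite memv_ker => /eqP gA0.
  by rewrite eA gA0 row_mx0 mem0v.
have WP B : B \in W -> row_mx 0 B \in V.
  case/memv_imgP => A; rewrite memv_cap => /andP[VA /kerP eA] ->.
  by rewrite -eA.
have isoW A B : A \in W -> B \in W -> A^T *m J *m B + B^T *m J *m A = 0.
  move=> /WP WA /WP WB; have := isoV _ _ WA WB.
  by rewrite !mul_tr_row_mx add_block_mx -block_mx0 => /eq_block_mx[].
have UW u B : u \in U -> B \in W -> u *m B = 0.
  case/memv_imgP => A VA -> /WP VB; rewrite fE; have := isoV _ _ VA VB.
  rewrite -{1 2}(hsubmxK A) !mul_tr_row_mx add_block_mx -block_mx0.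
  move=> /eq_block_mx[_ + _ _].
  by rewrite trmx0 !mul0mx addr0.
have := dim_annihilator UW.
have IHW : (0 < m)%N -> (\dim W <= r * m.+1)%N by move=> m0; exact: IHm.
move: IHW; rewrite -(limg_ker_dim f V) -/K -/U -dimW.
move: (\dim W) (\dim U) => w u; clear; case: (posnP m) => [-> _|_]; first lia.
(* When u > r: w + u <= 2r + m (2r - u) <= r (m + 2). *)
move=> /(_ isT); have [|] := leqP u r; nia.
Qed.

(** * Upper bound *)

Lemma congruent_constant_rank (F : fieldType) n k (P : 'M[F]_n)
    (S : affspace 'M[F]_n) :
  P \in unitmx -> {subset S <= antisymmx F n} -> constant_rank k S ->
  exists S' : affspace 'M[F]_n,
    [/\ origin S' = P *m origin S *m P^T, {subset S' <= antisymmx F n},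
        constant_rank k S' & affdim S' = affdim S].
Proof.
move=> uP aS rkS.
pose f := linfun (mulmxr P^T \o mulmx P : 'M[F]_n -> 'M[F]_n).
have fE A : f A = P *m A *m P^T by rewrite lfunE.
exists (AffSpace (P *m origin S *m P^T) (f @: direction S)%VS); split=> //.
- move=> A; rewrite in_affspace /= => /memv_imgP[B LB /eqP].
  rewrite subr_eq => /eqP ->; rewrite fE.
  have /aS : B + origin S \in S by rewrite in_affspace addrK.
  by rewrite !inE -mulmxDl -mulmxDr => /eqP/antisym_congr ->.
- move=> A; rewrite in_affspace /= => /memv_imgP[B LB /eqP].
  rewrite subr_eq => /eqP ->; rewrite fE -mulmxDl -mulmxDr.
  have /rkS <- : B + origin S \in S by rewrite in_affspace addrK.
  exact: mxrank_congr.
- apply: limg_dim_eq; apply/eqP; rewrite -subv0; apply/subvP => A.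
  have uPT : P^T \in unitmx by rewrite unitmx_tr.
  rewrite memv_cap memv_ker fE memv0 => /andP[_ /eqP/(canRL (mulmxK uPT))].
  by rewrite mul0mx => /(canRL (mulKmx uP)) ->; rewrite mulmx0.
Qed.

(** An antisymmetric A with blocks a, b, -b^T, d commutes with the symplectic
    matrix, that is, represents an anti-Hermitian matrix, when a = d and
    b = b^T. The antisymmetric matrices a - d and b - b^T measure the failure.
    Their r (r - 1) independent entries are stored off the diagonal of one
    matrix, those of a - d above it and those of b - b^T below it, and the
    diagonal is left out. *)
Definition offherm (F : fieldType) r (A : 'M[F]_(r + r)) : 'M[F]_(r, r.-1) :=
  \matrix_(i, j) if (i < lift i j)%N then (ulsubmx A - drsubmx A) i (lift i j)
                 else (ursubmx A - (ursubmx A)^T) i (lift i j).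

Lemma offherm_is_linear (F : fieldType) r : linear (@offherm F r).
Proof.
move=> a A B; apply/matrixP => i j; rewrite !mxE.
by case: ifP => _; ring.
Qed.

HB.instance Definition _ (F : fieldType) r :=
  GRing.isLinear.Build F 'M[F]_(r + r) 'M[F]_(r, r.-1) _ (@offherm F r)
    (@offherm_is_linear F r).

Lemma offherm_eq0 (F : numFieldType) r (A : 'M[F]_(r + r)) :
  A^T = - A -> offherm A = 0 ->
  ulsubmx A = drsubmx A /\ (ursubmx A)^T = ursubmx A.
Proof.
move=> aA /matrixP A0.
pose X := ulsubmx A - drsubmx A; pose Y := ursubmx A - (ursubmx A)^T.
have aX : X^T = - X.
  by rewrite linearB /= trmx_ulsub trmx_drsub aA !linearN /= -opprD.
have aY : Y^T = - Y by rewrite linearB /= trmxK opprB.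
have off (i k : 'I_r) : i != k -> (if (i < k)%N then X i k else Y i k) = 0.
  by case/unlift_some => j -> _; have := A0 i j; rewrite !mxE.
have skew (Z : 'M[F]_r) i k : Z^T = - Z -> Z k i = 0 -> Z i k = 0.
  by move=> /matrixP/(_ k i); rewrite !mxE => -> ->; rewrite oppr0.
have sub0 (Z : 'M[F]_r) :
    Z^T = - Z -> (forall i k : 'I_r, (i < k)%N -> Z i k = 0) -> Z = 0.
  move=> aZ Z0; apply/matrixP => i k; rewrite [RHS]mxE.
  case: (ltngtP i k) => [/Z0 //|/Z0 Zki|/val_inj ->]; first exact: skew.
  exact: antisym_diag0.
have X0 : X = 0.
  apply: sub0 => // i k ik; have := off i k; rewrite ik; apply.
  by apply: contraTneq ik => ->; rewrite ltnn.
have Y0 : Y = 0.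
  apply: sub0 => // i k ik; apply: skew => //; have := off k i.
  rewrite ltnNge (ltnW ik) /=; apply.
  by apply: contraTneq ik => ->; rewrite ltnn.
by split; [|symmetry]; apply/eqP; rewrite -subr_eq0; apply/eqP.
Qed.

(** When A commutes with J, the product J A is symmetric, and the identity
    1 + t J A = - J (J - t A) shows that it has no nonzero real eigenvalue. *)
Lemma offherm_nonsingular_pencil (R : rcfType) r (A : 'M[R]_(r + r)) :
  A^T = - A -> (forall t, symplmx R r + t *: A \in unitmx) ->
  offherm A = 0 -> A = 0.
Proof.
move=> aA unitA /(offherm_eq0 aA)[uldr ursym].
have ulA : (ulsubmx A)^T = - ulsubmx A by rewrite trmx_ulsub aA linearN.
have dlA : dlsubmx A = - ursubmx A.
  by rewrite -ursym trmx_ursub aA linearN opprK.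
suff JA0 : symplmx R r *m A = 0.
  by rewrite -[A](mulKmx (symplmx_unit R r)) JA0 mulmx0.
apply: symmx_no_real_eigenvalue_eq0 => [|t].
  rewrite -[A]submxK -uldr dlA /symplmx mulmx_block.
  rewrite !(mul0mx, mul1mx, addr0, add0r) !mulNmx !mul1mx tr_block_mx.
  by rewrite !linearN /= ursym ulA opprK.
have -> : 1%:M + t *: (symplmx R r *m A) =
    (- symplmx R r) *m (symplmx R r + (- t) *: A).
  rewrite mulmxDr !mulNmx symplmx_sqr opprK -scalemxAr.
  by rewrite scaleNr opprK.
by rewrite unitmx_mul unitA andbT -scaleN1r unitmxZ ?unitrN1 // symplmx_unit.
Qed.

(** Rank-nullity for the map that takes a direction to its border: the image is
    isotropic for J^-1, and [offherm] is injective on the corners of the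
    kernel. *)
Lemma affdim_le_standard (R : rcfType) r m (S : affspace 'M[R]_(r + r + m)) :
  origin S = block_mx (symplmx R r) 0 0 0 ->
  {subset S <= antisymmx R (r + r + m)} -> constant_rank (r + r) S ->
  (affdim S <= r * r.-1 + (r + r) * m)%N /\
  ((2 <= m)%N -> (affdim S <= r * r.-1 + r * m)%N).
Proof.
set J := symplmx R r; set L := direction S => oS aS rkS.
have memS t A : A \in L -> block_mx J 0 0 0 + t *: A \in S.
  by move=> LA; rewrite in_affspace oS addrC addKr memvZ.
have aL A : A \in L -> A^T = - A.
  move=> LA; have /aS := memS 1 _ LA; have /aS := memS 0 _ LA.
  rewrite !inE scale0r scale1r addr0 => /eqP a0.
  by rewrite linearD /= a0 opprD => /eqP/addrI.
have dlE A : A \in L -> dlsubmx A = - (ursubmx A)^T.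
  by move=> /aL aA; rewrite trmx_ursub aA linearN opprK.
have pencil A : A \in L -> drsubmx A = 0 /\
    (ursubmx A)^T *m invmx J *m ursubmx A = 0.
  move=> LA; have [|-> /eqP] := @constant_rank_pencil _ _ _ _ J (ulsubmx A)
    (ursubmx A) (dlsubmx A) (drsubmx A) (symplmx_unit R r).
    move=> t; have := rkS _ (memS t _ LA); rewrite -[A in _ *: A]submxK.
    by rewrite scale_block_mx add_block_mx !add0r.
  by rewrite dlE // !mulNmx oppr_eq0 => /eqP.
pose f := linfun (ursubmx : 'M[R]_(r + r + m) -> 'M[R]_(r + r, m)).
have fE A : f A = ursubmx A by rewrite lfunE.
have isoV A B : A \in (f @: L)%VS -> B \in (f @: L)%VS ->
    A^T *m invmx J *m B + B^T *m invmx J *m A = 0.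
  case/memv_imgP => A' LA -> /memv_imgP[B' LB ->].
  have [_] := pencil _ (memvD LA LB); have [_] := pencil _ LA.
  have [_] := pencil _ LB; rewrite -!fE !linearD /= !mulmxDl => -> ->.
  by rewrite add0r addr0 addrC.
have kerP A : A \in (L :&: lker f)%VS -> [/\ A = block_mx (ulsubmx A) 0 0 0,
    (ulsubmx A)^T = - ulsubmx A & forall t, J + t *: ulsubmx A \in unitmx].
  rewrite memv_cap memv_ker fE => /andP[LA /eqP ur0].
  have eA : A = block_mx (ulsubmx A) 0 0 0.
    by rewrite -[LHS]submxK dlE // ur0 (pencil _ LA).1 trmx0 oppr0.
  split=> // [|t]; first by rewrite trmx_ulsub aL // linearN.
  have := rkS _ (memS t _ LA); rewrite {1}eA scale_block_mx add_block_mx.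
  rewrite !scaler0 !addr0 rank_diag_block_mx mxrank0 addn0.
  by rewrite -row_free_unit /row_free => ->.
pose h := linfun (@offherm R r \o
  (ulsubmx : 'M[R]_(r + r + m) -> 'M[R]_(r + r))).
have dimK : (\dim (L :&: lker f) <= r * r.-1)%N.
  have <- : \dim (h @: (L :&: lker f)) = \dim (L :&: lker f).
    apply: limg_dim_eq; apply/eqP; rewrite -subv0; apply/subvP => A.
    rewrite memv_cap memv_ker lfunE => /andP[/kerP[eA aA uA] /eqP hA].
    by rewrite memv0 eA (offherm_nonsingular_pencil aA uA hA) block_mx0.
  by rewrite -(dim_fullmx R r r.-1) dimvS // subvf.
rewrite /affdim -/L -(limg_ker_dim f L); split=> [|m2]; apply: leq_add => //.
  by rewrite -(dim_fullmx R (r + r) m) dimvS // subvf.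
by apply: dim_isotropic isoV m2; rewrite unitmx_inv symplmx_unit.
Qed.

Lemma affdim_le (R : rcfType) r m (S : affspace 'M[R]_(r + r + m)) :
  {subset S <= antisymmx R (r + r + m)} -> constant_rank (r + r) S ->
  (affdim S <= r * r.-1 + (r + r) * m)%N /\
  ((2 <= m)%N -> (affdim S <= r * r.-1 + r * m)%N).
Proof.
move=> aS rkS; have oS : origin S \in S by rewrite in_affspace subrr mem0v.
have /eqP ao : origin S \in antisymmx R _ by apply: aS.
have [P uP PoS] := antisym_normal_form ao (rkS _ oS).
have [S' [oS' aS' rkS' <-]] := congruent_constant_rank uP aS rkS.
by apply: affdim_le_standard => //; rewrite oS'.
Qed.

(** * Construction of spaces of constant rank *)

Definition lagblock (F : fieldType) r (X U : 'M[F]_r) : 'M[F]_(r + r) :=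
  block_mx X U (- U^T) 0.

Lemma lagblock_antisym (F : fieldType) r (X U : 'M[F]_r) :
  X^T = - X -> (lagblock X U)^T = - lagblock X U.
Proof.
move=> aX; rewrite tr_block_mx opp_block_mx aX linearN /= trmxK opprK.
by rewrite trmx0 oppr0.
Qed.

Lemma lagblock_mulV (F : fieldType) r (X U : 'M[F]_r) : U \in unitmx ->
  lagblock X U *m block_mx 0 (- (invmx U)^T) (invmx U)
    (invmx U *m X *m (invmx U)^T) = 1%:M.
Proof.
move=> uU; rewrite mulmx_block !mulmx0 !mul0mx !addr0 add0r mulmxV //.
rewrite mulNmx !mulmxN opprK -trmx_mul mulVmx // trmx1 !mulmxA mulmxV //.
by rewrite mul1mx addNr -scalar_mx_block.
Qed.

Lemma lagblock_unit (F : fieldType) r (X U : 'M[F]_r) :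
  U \in unitmx -> lagblock X U \in unitmx.
Proof. by move=> /lagblock_mulV -/(_ X)/mulmx1_unit[]. Qed.

Lemma invmx_lagblock (F : fieldType) r (X U : 'M[F]_r) : U \in unitmx ->
  invmx (lagblock X U) = block_mx 0 (- (invmx U)^T) (invmx U)
    (invmx U *m X *m (invmx U)^T).
Proof.
move=> uU; rewrite -[LHS]mulmx1 -(lagblock_mulV X uU) mulmxA.
by rewrite mulVmx ?mul1mx // lagblock_unit.
Qed.

(** The inverse of deleting the diagonal: the r (r - 1) entries of [Z] are the
    parameters of both the antisymmetric and the triangular block below. *)
Definition spreadmx (F : fieldType) r (Z : 'M[F]_(r, r.-1)) : 'M[F]_r :=
  \matrix_(i, k) if unlift i k is Some j then Z i j else 0.

Definition antisym_part (F : fieldType) r (Z : 'M[F]_(r, r.-1)) : 'M[F]_r :=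
  \matrix_(i, k) ((if (i < k)%N then spreadmx Z i k else 0) -
                  (if (k < i)%N then spreadmx Z k i else 0)).

Definition lower_part (F : fieldType) r (Z : 'M[F]_(r, r.-1)) : 'M[F]_r :=
  \matrix_(i, k) if (k < i)%N then spreadmx Z i k else 0.

Lemma antisym_part_antisym (F : fieldType) r (Z : 'M[F]_(r, r.-1)) :
  (antisym_part Z)^T = - antisym_part Z.
Proof. by apply/matrixP => i k; rewrite !mxE opprB. Qed.

Lemma unitmx_lower_part (F : fieldType) r (Z : 'M[F]_(r, r.-1)) :
  1%:M + lower_part Z \in unitmx.
Proof.
rewrite unitmxE det_trig.
  by rewrite big1 ?unitr1 // => i _; rewrite !mxE ltnn eqxx addr0.
apply/is_trig_mxP => i j ij; rewrite !mxE ltnNge (ltnW ij) addr0.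
by rewrite -val_eqE /= (ltn_eqF ij).
Qed.

Lemma parts_eq0 (F : fieldType) r (Z : 'M[F]_(r, r.-1)) :
  antisym_part Z = 0 -> lower_part Z = 0 -> Z = 0.
Proof.
move=> /matrixP aZ /matrixP lZ; apply/matrixP => i j; rewrite [RHS]mxE.
have := lZ i (lift i j); have := aZ i (lift i j).
rewrite !mxE liftK; case: ltngtP => [_|_|/val_inj e]; rewrite ?subr0 //.
by have := neq_lift i j; rewrite -e eqxx.
Qed.

Definition bordered (F : fieldType) r m q
    (phi : {linear 'M[F]_(r, q) -> 'M[F]_(r + r, m)})
    (W : 'M[F]_(r, r.-1 + q)) : 'M[F]_(r + r + m) :=
  block_mx (lagblock (antisym_part (lsubmx W)) (lower_part (lsubmx W)))
           (phi (rsubmx W)) (- (phi (rsubmx W))^T) 0.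

Lemma bordered_is_linear (F : fieldType) r m q
    (phi : {linear 'M[F]_(r, q) -> 'M[F]_(r + r, m)}) :
  linear (bordered phi).
Proof.
move=> a A B; rewrite /bordered /lagblock !linearP /=.
rewrite !(scale_block_mx, add_block_mx) !scaler0 !addr0.
congr (block_mx (block_mx _ _ _ _) _ _ _).
- apply/matrixP => i j; rewrite !mxE.
  by case: unlift => [?|]; case: unlift => [?|]; rewrite ?mxE;
    case: ltngtP => _; rewrite ?mxE; ring.
- apply/matrixP => i j; rewrite !mxE.
  by case: unlift => [?|]; case: ltngtP => _; rewrite ?mxE; ring.
- apply/matrixP => i j; rewrite !mxE.
  by case: unlift => [?|]; case: ltngtP => _; rewrite ?mxE; ring.
Qed.

HB.instance Definition _ (F : fieldType) r m q
    (phi : {linear 'M[F]_(r, q) -> 'M[F]_(r + r, m)}) :=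
  GRing.isLinear.Build F 'M[F]_(r, r.-1 + q) 'M[F]_(r + r + m) _ (bordered phi)
    (bordered_is_linear phi).

(** Bordering a nonsingular N by B, -B^T and 0 adds nothing to the rank as soon
    as the Schur complement B^T N^-1 B vanishes, so any linear space of borders
    with this property can be added to the nonsingular affine space. The origin
    is the symplectic matrix, that is, X = 0 and U = 1. *)
Lemma antisym_constant_rank_exists (F : fieldType) r m q
    (phi : {linear 'M[F]_(r, q) -> 'M[F]_(r + r, m)}) :
  injective phi ->
  (forall Y X U, X^T = - X -> U \in unitmx ->
     (phi Y)^T *m invmx (lagblock X U) *m phi Y = 0) ->
  antisym_constant_rank_dim F (r + r + m) (r + r) (r * (r.-1 + q)).
Proof.
move=> inj_phi isophi; pose f := linfun (bordered phi).
pose O : 'M[F]_(r + r + m) := block_mx (symplmx F r) 0 0 0.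
exists (AffSpace O (limg f)).
have SP A : A \in AffSpace O (limg f) -> exists X U Y,
    [/\ X^T = - X, U \in unitmx &
        A = block_mx (lagblock X U) (phi Y) (- (phi Y)^T) 0].
  rewrite in_affspace /= => /memv_imgP[W _ /eqP]; rewrite subr_eq => /eqP ->.
  exists (antisym_part (lsubmx W)), (1%:M + lower_part (lsubmx W)), (rsubmx W).
  split; [exact: antisym_part_antisym | exact: unitmx_lower_part |].
  rewrite lfunE /= /bordered /O /symplmx /lagblock !add_block_mx !addr0.
  by rewrite linearD /= trmx1 opprD [1%:M + _]addrC [- 1%:M - _]addrC.
split.
- move=> A /SP[X [U [Y [aX uU ->]]]]; rewrite inE tr_block_mx opp_block_mx.
  by rewrite lagblock_antisym // linearN /= trmxK opprK trmx0 oppr0.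
- move=> A /SP[X [U [Y [aX uU ->]]]]; apply/eqP.
  by rewrite rank_block_schur ?lagblock_unit // !mulNmx isophi // oppr0.
- rewrite /affdim /= -(dim_fullmx F r (r.-1 + q)); apply: limg_dim_eq.
  apply/eqP; rewrite capfv -subv0; apply/subvP => W.
  rewrite memv_ker lfunE memv0 => /eqP; rewrite /= /bordered -block_mx0.
  move=> /eq_block_mx[+ phi0 _ _].
  rewrite /lagblock -[X in _ = X -> _]block_mx0.
  move=> /eq_block_mx[X0 T0 _ _].
  have Y0 : rsubmx W = 0 by apply: inj_phi; rewrite phi0 linear0.
  by rewrite -[W]hsubmxK Y0 (parts_eq0 X0 T0) row_mx0.
Qed.

Definition top_border (F : fieldType) r m (Y : 'M[F]_(r, m)) :
  'M[F]_(r + r, m) := col_mx Y 0.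

Lemma top_border_is_linear (F : fieldType) r m : linear (@top_border F r m).
Proof.
by move=> a A B; rewrite /top_border scale_col_mx add_col_mx scaler0 addr0.
Qed.

HB.instance Definition _ (F : fieldType) r m :=
  GRing.isLinear.Build F 'M[F]_(r, m) 'M[F]_(r + r, m) _ (@top_border F r m)
    (@top_border_is_linear F r m).

(** An arbitrary column of height 2r, cut into two columns of height r so that
    its parameters have r rows like those of the other blocks. *)
Definition column_border (F : fieldType) r (Y : 'M[F]_(r, 1 + 1)) :
  'M[F]_(r + r, 1) := col_mx (lsubmx Y) (rsubmx Y).

Lemma column_border_is_linear (F : fieldType) r : linear (@column_border F r).
Proof.
by move=> a A B; rewrite /column_border !linearP scale_col_mx add_col_mx.
Qed.

HB.instance Definition _ (F : fieldType) r :=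
  GRing.isLinear.Build F 'M[F]_(r, 1 + 1) 'M[F]_(r + r, 1) _
    (@column_border F r) (@column_border_is_linear F r).

(** The inverse of the nonsingular block has a zero upper left block, so borders
    concentrated in the upper half are isotropic for it. *)
Lemma antisym_constant_rank_exists_top (F : fieldType) r m :
  antisym_constant_rank_dim F (r + r + m) (r + r) (r * (r.-1 + m)).
Proof.
apply: (@antisym_constant_rank_exists F r m m (@top_border F r m)).
  by move=> A B /eq_col_mx[].
move=> Y X U _ uU; rewrite invmx_lagblock // /= /top_border tr_col_mx trmx0.
by rewrite mul_row_block mul_row_col !mul0mx !mulmx0 !addr0 mul0mx.
Qed.

(** For a single column B the product B^T N^-1 B is an antisymmetric matrix of
    size 1, hence 0. *)
Lemma antisym_constant_rank_exists_column (F : numFieldType) r :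
  antisym_constant_rank_dim F (r + r + 1) (r + r) (r * (r.-1 + 2)).
Proof.
apply: (@antisym_constant_rank_exists F r 1 2 (@column_border F r)).
  move=> A B /eq_col_mx[eql eqr].
  by rewrite -(@hsubmxK F r 1 1 A) eql eqr hsubmxK.
move=> Y X U aX uU; apply/matrixP => i j; rewrite !ord1 [RHS]mxE.
apply: antisym_diag0; rewrite !trmx_mul trmxK mulmxA trmx_inv.
rewrite lagblock_antisym //.
have uN : lagblock X U \in unitmx by apply: lagblock_unit.
by rewrite -scaleN1r invmxZ ?unitmxZ ?unitrN1 // invrN1 scaleN1r mulmxN mulNmx.
Qed.

Local Close Scope ring_scope.

(** Put m = n - 2r. The construction has r (r.-1 + q) parameters, where q = 2 if
    m = 1 and q = m otherwise; this is the value of the upper bound. *)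
Theorem theorem6 (R : realType) (n r : nat) :
  [/\ 2 * r + 2 <= n -> a_antisym_eq R n (2 * r) ((n - r - 1) * r),
      n = 2 * r -> a_antisym_eq R n (2 * r) (r * (r - 1))
    & n = 2 * r + 1 -> a_antisym_eq R n (2 * r) (r * (r + 1))].
Proof.
rewrite mul2n -addnn; split=> [le_n | -> | ->].
- have [m m2 ->] : exists2 m, (2 <= m)%N & n = (r + r + m)%N.
    by exists (n - (r + r))%N; lia.
  have -> : ((r + r + m - r - 1) * r = r * (r.-1 + m))%N.
    case: (r) => [|k]; first by rewrite muln0.
    by rewrite mulnC; congr muln; lia.
  split=> [|_ [S [aS rkS <-]]]; first exact: antisym_constant_rank_exists_top.
  by rewrite mulnDr; apply: (affdim_le aS rkS).2.
- rewrite -[X in a_antisym_eq _ X]addn0 subn1.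
  split=> [|_ [S [aS rkS <-]]].
    by rewrite -[r.-1]addn0; apply: antisym_constant_rank_exists_top.
  by have [+ _] := affdim_le aS rkS; rewrite muln0 [(_ * _ + 0)%N]addn0.
- have -> : (r * (r + 1) = r * (r.-1 + 2))%N.
    by case: (r) => //= k; congr muln; lia.
  split=> [|_ [S [aS rkS <-]]].
    exact: antisym_constant_rank_exists_column.
  by have [+ _] := affdim_le aS rkS; rewrite mulnDr muln1 muln2 -addnn.
Qed.
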